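(* Let $d\ge 1$, $N\ge 0$ and $M\ge 0$ be integers. Let $\bm{P}^{N+M}_N$ be the matrix, with respect to the Bernstein bases of degrees $N+M$ and $N$ on the reference simplex $\widehat D\subset\mathbb{R}^d$, of the $L^2(\widehat D)$-orthogonal projection from $P^{N+M}(\widehat D)$ onto $P^N(\widehat D)$, and let $\bm{E}^{a}_{b}$ ($0\le b\le a$) denote the Bernstein degree elevation matrix from degree $b$ to degree $a$. Then there exist real numbers $c_j$, $0\le j\le N$, such that $$\bm{P}^{N+M}_N=\sum_{j=0}^{N} c_j\,\bm{E}^N_{N-j}\left(\bm{E}^N_{N-j}\right)^T\left(\bm{E}^{N+M}_N\right)^T .$$
   Context: The reference simplex is $\widehat D=\{x\in\mathbb{R}^d: x_i\ge -1 \ (1\le i\le d),\ \sum_{i=1}^d x_i\le 2-d\}$, with barycentric coordinates $\lambda_i=(1+x_i)/2$ for $1\le i\le d$ and $\lambda_0=1-\sum_{i=1}^d\lambda_i$. $P^N(\widehat D)$ is the space of real polynomials of total degree at most $N$ on $\widehat D$; its dimension is $N_p=\binom{N+d}{d}$. For a multi-index $\bm{\alpha}=(\alpha_0,\dots,\alpha_d)$ of nonnegative integers with $|\bm{\alpha}|:=\sum_{i=0}^d\alpha_i=N$, the Bernstein basis function is $B^N_{\bm{\alpha}}=\frac{N!}{\alpha_0!\cdots\alpha_d!}\lambda_0^{\alpha_0}\cdots\lambda_d^{\alpha_d}$. The functions $\{B^N_{\bm{\alpha}}\}_{|\bm{\alpha}|=N}$ form a basis of $P^N(\widehat D)$. Degree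 elevation matrix: for $0\le b\le a$, $\bm{E}^a_b\in\mathbb{R}^{a_p\times b_p}$ (where $k_p=\dim P^k(\widehat D)$) is the matrix mapping the coefficient vector of a polynomial $p\in P^b(\widehat D)$ in the degree-$b$ Bernstein basis to the coefficient vector of the same polynomial $p$ in the degree-$a$ Bernstein basis; $\bm{E}^a_a$ is the identity. Superscript $T$ denotes matrix transpose. Projection matrix: $\bm{P}^{N+M}_N\in\mathbb{R}^{N_p\times (N+M)_p}$ maps the degree-$(N+M)$ Bernstein coefficients of $p\in P^{N+M}(\widehat D)$ to the degree-$N$ Bernstein coefficients of the $L^2(\widehat D)$-orthogonal projection of $p$ onto $P^N(\widehat D)$. *)

(* Defs.v *)
From HB Require Import structures.
From mathcomp Require Import all_boot all_order all_algebra.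
From mathcomp Require Import all_classical all_reals all_analysis.
From mathcomp Require mpoly.

Set Implicit Arguments.
Unset Strict Implicit.
Unset Printing Implicit Defensive.
Import Order.TTheory GRing.Theory Num.Theory.
Local Open Scope classical_set_scope.
Local Open Scope ring_scope.

Section with_sigma_finite.
Context d (T : measurableType d) (R : realType) (m : {measure set T -> \bar R}).
Hypothesis m_sigma_finite : sigma_finite setT m.

Definition with_sigma_finite of sigma_finite setT m : set T -> \bar R := m.

HB.instance Definition _ := Measure.on (with_sigma_finite m_sigma_finite).
HB.instance Definition _ := Measure_isSigmaFinite.Build _ _ _
  (with_sigma_finite m_sigma_finite) m_sigma_finite.

End with_sigma_finite.

Section lebesgue_measure_tuple.
Context {R : realType}.
Local Notation T := (measurableTypeR R).

Definition tuple_cons n (xy : (T * n.-tuple T)%type) : n.+1.-tuple T :=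
  [the n.+1.-tuple T of xy.1 :: xy.2].

(* Lebesgue measure on the Borel sets of R^n, through R^n.+1 = R * R^n. *)
Fixpoint lebesgue_tuple n : set (n.-tuple T) -> \bar R :=
  if n isn't n'.+1 return set (n.-tuple T) -> \bar R
  then dirac [tuple]
  else pushforward (@lebesgue_measure R \x @lebesgue_tuple n')%E
         (@tuple_cons n').

Lemma measurable_tuple_cons n : measurable_fun setT (@tuple_cons n).
Proof. exact: measurable_cons. Qed.

Lemma sigma_finite_tuple_cons n
    (m : {sigma_finite_measure set (n.-tuple T) -> \bar R}) :
  sigma_finite setT
    (pushforward (@lebesgue_measure R \x m)%E (@tuple_cons n)).
Proof.
have /sigma_finiteP[F [FT ndF mF]] := sigma_finiteT (@lebesgue_measure R).
have /sigma_finiteP[G [GT ndG mG]] := sigma_finiteT m.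
pose g (t : n.+1.-tuple T) : (T * n.-tuple T)%type :=
  (thead t, [tuple of behead t]).
have mg : measurable_fun setT g.
  by apply: measurable_fun_pair; [exact: measurable_tnth|
                                  exact: measurable_behead].
exists (fun k => g @^-1` (F k `*` G k)).
  apply/esym; rewrite -subTset => t _.
  have [i _ Fi] : (\bigcup_i F i) (thead t) by rewrite -FT.
  have [j _ Gj] : (\bigcup_j G j) [tuple of behead t] by rewrite -GT.
  exists (maxn i j) => //; split.
  - by move: Fi; apply/subsetPset/ndF/leq_maxl.
  - by move: Gj; apply/subsetPset/ndG/leq_maxr.
move=> k; have [mFk Fk] := mF k; have [mGk Gk] := mG k; split.
  by rewrite -[X in measurable X]setTI; apply: mg => //; exact: measurableX.
rewrite /pushforward -comp_preimage (_ : g \o _ = id); last first.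
  by apply/funext => -[x t]; rewrite /g /= theadE; congr pair; exact: val_inj.
rewrite preimage_id product_measure1E//.
by rewrite lte_mul_pinfty// ge0_fin_numE.
Qed.

Lemma lebesgue_tupleP n :
  exists m : {sigma_finite_measure set (n.-tuple T) -> \bar R},
    @lebesgue_tuple n = m.
Proof.
elim: n => [|n [m IHm]] /=; first by eexists (dirac _).
rewrite IHm.
by eexists (with_sigma_finite
  (m := measure_function_pushforward__canonical__measure_function_Measure
    (@lebesgue_measure R \x m)%E (@measurable_tuple_cons n))
  (sigma_finite_tuple_cons m)).
Qed.

Section instance.
Variable n : nat.
Let mu := @lebesgue_tuple n.
Let mu0 : mu set0 = 0%E.
Proof. by have [m mE] := lebesgue_tupleP n; rewrite /mu mE measure0. Qed.
Let mu_ge0 A : (0 <= mu A)%E.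
Proof. by have [m mE] := lebesgue_tupleP n; rewrite /mu mE measure_ge0. Qed.
Let mu_sigma_additive : semi_sigma_additive mu.
Proof.
by have [m mE] := lebesgue_tupleP n; rewrite /mu mE;
  exact: measure_semi_sigma_additive.
Qed.
HB.instance Definition _ := isMeasure.Build _ _ _ (@lebesgue_tuple n)
  mu0 mu_ge0 mu_sigma_additive.
Let mu_sigma_finite : sigma_finite setT mu.
Proof. by have [m mE] := lebesgue_tupleP n; rewrite /mu mE; exact: sigma_finiteT. Qed.
HB.instance Definition _ := Measure_isSigmaFinite.Build _ _ _
  (@lebesgue_tuple n) mu_sigma_finite.
End instance.

End lebesgue_measure_tuple.

(* The notations of mpoly clash with those of mathcomp-analysis. *)
Import -(notations) mpoly.

Section bernstein.
Variables (R : realType) (d : nat).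

Definition simplex : set (d.-tuple (measurableTypeR R)) :=
  [set x | (forall i, -1 <= (tnth x i : R)) /\
           \sum_(i < d) (tnth x i : R) <= 2 - d%:R].

(* lambda_k is indexed by lift ord0 i with i = k - 1; lambda_0 by ord0. *)
Definition barycentric (k : 'I_d.+1) : mpoly d R :=
  let lambda i := 2^-1 *: (1 + mpolyX R (mnm1 i)) in
  if unlift ord0 k is Some i then lambda i else 1 - \sum_(i < d) lambda i.

Definition poly_space N : set (mpoly d R) := [set p | (msize p <= N.+1)%N].

Definition multi_index N : {set d.+1.-tuple 'I_N.+1} :=
  [set a : d.+1.-tuple 'I_N.+1 | (\sum_(i <- a) i)%N == N]%SET.

Definition bernstein N (a : d.+1.-tuple 'I_N.+1) : mpoly d R :=
  (N`!%:R / \prod_(i < d.+1) (tnth a i)`!%:R) *: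
    \prod_(i < d.+1) barycentric i ^+ tnth a i.

(* Equal to 'C(N + d, d), by card_ord_partitions. *)
Definition dimP N : nat := #|multi_index N|.

(* The polynomial with coefficient vector c in the Bernstein basis, whose
   elements are ordered by enum (multi_index N). *)
Definition bernstein_form N (c : 'cV[R]_(dimP N)) : mpoly d R :=
  \sum_(i < dimP N) c i 0 *: bernstein (enum_val i).

Definition dotL2 (p q : mpoly d R) : R :=
  \int[@lebesgue_tuple R d]_(x in simplex)
    (meval (tnth x) p * meval (tnth x) q).

Definition is_orthogonal_projection N (p q : mpoly d R) : Prop :=
  poly_space N q /\ forall r, poly_space N r -> dotL2 (p - q) r = 0.

Definition is_elevation_mx a b (E : 'M[R]_(dimP a, dimP b)) : Prop :=
  forall p c, poly_space b p ->
    p = bernstein_form c -> p = bernstein_form (E *m c).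

Definition is_projection_mx a b (P : 'M[R]_(dimP b, dimP a)) : Prop :=
  forall p c, poly_space a p -> p = bernstein_form c ->
    is_orthogonal_projection b p (bernstein_form (P *m c)).

(* Since the Bernstein polynomials form a basis, these matrices exist and are
   unique for b <= a. *)
Definition elevation_mx a b : 'M[R]_(dimP a, dimP b) :=
  xget 0 (@is_elevation_mx a b).

Definition projection_mx a b : 'M[R]_(dimP b, dimP a) :=
  xget 0 (@is_projection_mx a b).

End bernstein.

(* Main.v *)
(* Let T be the matrix with entries prod_k C(alpha_k + beta_k, alpha_k). By the
   Dirichlet integral the Gram matrix G(N,K) between the Bernstein bases of
   degrees N and K is a nonzero multiple of T, and by the multinomial theorem
   E^a_b has entries prod_k C(beta_k, gamma_k) / C(a, b). Since
   G(N,N) E^N_(N-j) = G(N,N-j) and P = G(N,N)^-1 G(N,N+M), the claim amounts to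
   T(alpha, beta) = sum_j e_j sum_(|gamma| = N-j)
                      prod_k C(alpha_k + gamma_k, alpha_k) C(beta_k, gamma_k)
   for |alpha| = N and |beta| = N + M. The inner sum is the coefficient of
   x^(N-j) in prod_k F_k, F_k = sum_n C(alpha_k + n, alpha_k) C(beta_k, n) x^n.
   By Euler's transformation of 2F1, F_k = (1 + x)^(beta_k - alpha_k) S_k where
   S_k has degree alpha_k and leading coefficient C(alpha_k + beta_k, alpha_k).
   So prod_k F_k = (1 + x)^M prod_k S_k, the coefficient of x^N in prod_k S_k is
   T(alpha, beta), and the e_j are the coefficients of (1 + x)^-M. *)
Require Import Defs.
From mathcomp Require Import all_boot all_order all_algebra.
From mathcomp Require Import all_classical all_reals all_analysis.
From mathcomp Require Import measurable_realfun zify ring lra.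
From mathcomp Require mpoly.
Import Order.TTheory GRing.Theory Num.Theory numFieldNormedType.Exports.
Import -(notations) mpoly.
Local Open Scope ring_scope.

Set Implicit Arguments.
Unset Strict Implicit.
Unset Printing Implicit Defensive.

(** * Binomial identities *)

Section BinomialPolynomials.
Variable R : comNzRingType.

(** Congruence modulo ['X^(n.+1)], so that truncated power series can be handled as polynomials. *)
Definition eqmodXn n (p q : {poly R}) := forall k, (k <= n)%N -> p`_k = q`_k.

Lemma eqmodXnM n p q p' q' :
  eqmodXn n p p' -> eqmodXn n q q' -> eqmodXn n (p * q) (p' * q').
Proof.
move=> pp' qq' k kn; rewrite !coefM; apply: eq_bigr => i _.
by rewrite pp' ?qq'// (leq_trans _ kn) ?leq_subr// -ltnS.
Qed.

Lemma eqmodXn_prod (I : finType) n (p q : I -> {poly R}) :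
  (forall i, eqmodXn n (p i) (q i)) -> eqmodXn n (\prod_i p i) (\prod_i q i).
Proof.
move=> pq; elim/big_ind2: _ => //.
by move=> *; exact: eqmodXnM.
Qed.

Lemma coefM_top n m (p q : {poly R}) : (size p <= n.+1)%N -> (size q <= m.+1)%N ->
  (p * q)`_(n + m) = p`_n * q`_m.
Proof.
move=> sp sq; rewrite coefM.
have nlt : (n < (n + m).+1)%N by rewrite ltnS leq_addr.
rewrite (bigD1 (Ordinal nlt))//= addKn big1 ?addr0// => i ni.
have [lin|leni] := ltnP i n.
  by rewrite [q`_ _]nth_default ?mulr0//; move: lin sq => /=; lia.
rewrite [p`_ _]nth_default ?mul0r// (leq_trans sp)// ltn_neqAle leni andbT.
by apply: contraNneq ni => e; apply/eqP/val_inj.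
Qed.

Lemma size_prod_top (I : finType) (n : I -> nat) (p : I -> {poly R}) :
  (forall i, size (p i) <= (n i).+1)%N ->
  (size (\prod_i p i)%R <= (\sum_i n i).+1)%N /\
  (\prod_i p i)`_(\sum_i n i)%N = \prod_i (p i)`_(n i).
Proof.
move=> sp; elim/big_rec3: _ => [|i x m q _ [sq cq]].
  by rewrite size_poly1 coef1.
split; last by rewrite coefM_top ?sp// cq.
by have := size_polyMleq (p i) q; have := sp i; lia.
Qed.

(* With y = 1 + x, the sum of [binpoly a b] u^a v^b is 1 / (1 - u - y v + u v),
   which is symmetric under (u, v) -> (y v, u / y): this is [binpoly_sym]. *)
Definition binpoly a b : {poly R} :=
  \poly_(n < b.+1) ('C(a + n, a) * 'C(b, n))%:R.

Lemma coef_binpoly a b n : (binpoly a b)`_n = ('C(a + n, a) * 'C(b, n))%:R.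
Proof.
rewrite coef_poly; case: ltnP => // bn.
by rewrite (bin_small bn) muln0.
Qed.

Lemma binpoly0l b : binpoly 0 b = (1 + 'X) ^+ b.
Proof.
rewrite /binpoly poly_def addrC exprD1n; apply: eq_bigr => n _.
by rewrite bin0 mul1n scaler_nat.
Qed.

Lemma binpoly0r a : binpoly a 0 = 1.
Proof.
apply/polyP => -[|n]; rewrite coef_binpoly coef1 ?addn0 ?binn//.
by rewrite muln0.
Qed.

(** The recurrence encoded by the denominator 1 - u - y v + u v of the generating function;
    coefficientwise it is Pascal's rule. *)
Lemma binpolySS a b : binpoly a.+1 b.+1 =
  binpoly a b.+1 + (1 + 'X) * binpoly a.+1 b - binpoly a b.
Proof.
apply/polyP => -[|n]; rewrite coefB coefD mulrDl mul1r coefD coefXM !coef_binpoly/=.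
  by rewrite !addn0 !binn !bin0; ring.
apply/eqP; rewrite -subr_eq0; apply/eqP.
have -> : (a.+1 + n.+1 = (a + n).+2)%N by lia.
rewrite addSn addnS (binS (a + n).+1) (binS b) !natrM !natrD; ring.
Qed.

Lemma binpoly_sym a b :
  (1 + 'X) ^+ a * binpoly a b = (1 + 'X) ^+ b * binpoly b a.
Proof.
have [n] := ubnP (a + b); elim: n a b => // n IH [|a] [|b] // abn.
- by rewrite binpoly0l binpoly0r expr0 mul1r mulr1.
- by rewrite binpoly0l binpoly0r expr0 mul1r mulr1.
have h1 := IH a b.+1; have h2 := IH a.+1 b; have h3 := IH a b.
rewrite !binpolySS.
have {}h1 := h1 ltac:(lia); have {}h2 := h2 ltac:(lia); have {}h3 := h3 ltac:(lia).
move: h1 h2 h3; rewrite !exprS; set y := 1 + 'X => h1 h2 h3.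
(* Each summand is [y] times the left side of an induction hypothesis. Rewriting with them exchanges
   the roles of the first two summands, which gives the recurrence for [binpoly b.+1 a.+1]. *)
transitivity (y * (y ^+ a * binpoly a b.+1) + y * (y * y ^+ a * binpoly a.+1 b)
  - y * (y ^+ a * binpoly a b)); first by ring.
by rewrite h1 h2 h3; ring.
Qed.

(** The truncated geometric series in -X inverts 1 + X, and its m-th power inverts (1 + X)^m. *)
Lemma inverse_modXn n m :
  exists e : {poly R}, eqmodXn n (e * (1 + 'X) ^+ m) 1.
Proof.
pose g : {poly R} := \sum_(j < n.+1) (- 'X) ^+ j.
have g1 : eqmodXn n (g * (1 + 'X)) 1.
  have -> : g * (1 + 'X) = 1 - (- 'X) ^+ n.+1.
    by rewrite -[RHS]opprB subrX1 -/g; ring.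
  by move=> k kn; rewrite coefB exprNn coefMXn ltnS kn subr0.
exists (g ^+ m); rewrite -exprMn_comm; last exact: mulrC.
elim: m => [//|m IH].
by rewrite exprS -[1 in X in eqmodXn _ _ X]mulr1; exact: eqmodXnM.
Qed.

End BinomialPolynomials.

Lemma sum_multi_indexE d N (a : d.+1.-tuple 'I_N.+1) : a \in multi_index d N ->
  (\sum_k tnth a k = N)%N.
Proof. by rewrite inE big_tuple => /eqP. Qed.

(** Expand the product and collect the terms of degree [N]. Coefficients above [N] cannot
    contribute, so each [p k] may be replaced by its truncation [q k]. *)
Lemma sum_multi_index (A : comNzRingType) d N (f : 'I_d.+1 -> nat -> A)
    (p : 'I_d.+1 -> {poly A}) :
  (forall k n, (n <= N)%N -> (p k)`_n = f k n) ->
  \sum_(a in multi_index d N) \prod_k f k (tnth a k) = (\prod_k p k)`_N.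
Proof.
move=> pf.
pose q k := \sum_(n < N.+1) f k n *: 'X^n.
have -> : (\prod_k p k)`_N = (\prod_k q k)`_N.
  apply: eqmodXn_prod (leqnn N) => k n nN.
  by rewrite /q -poly_def coef_poly ltnS nN pf.
rewrite /q bigA_distr_bigA/= coef_sum.
transitivity (\sum_(h : {ffun 'I_d.+1 -> 'I_N.+1} | (\sum_k h k == N)%N)
    \prod_k f k (h k)); last first.
  rewrite [LHS]big_mkcond; apply: eq_bigr => h _.
  rewrite scaler_prod prodrXr coefZ coefXn eq_sym.
  by case: eqP => _; rewrite ?mulr1 ?mulr0.
rewrite (reindex (fun h : {ffun 'I_d.+1 -> 'I_N.+1} => [tuple h k | k < d.+1]))/=.
  apply: eq_big => [h|h _]; last by apply: eq_bigr => k _; rewrite tnth_mktuple.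
  by rewrite inE big_tuple; congr (_ == _); apply: eq_bigr => k _; rewrite tnth_mktuple.
exists (fun t : d.+1.-tuple 'I_N.+1 => [ffun k => tnth t k]) => [h _|t _].
  by apply/ffunP => k; rewrite ffunE tnth_mktuple.
by apply: eq_from_tnth => k; rewrite tnth_mktuple ffunE.
Qed.

(** * Multinomial theorem via truncated exponential series *)

Section Multinomial.
Variables (R : numFieldType) (A : comAlgType R).

(** The series exp(x X) truncated after degree [N]. *)
Definition exp_poly N (x : A) : {poly A} := \poly_(n < N.+1) (n`!%:R^-1 *: x ^+ n).

Lemma exp_polyD N x y :
  eqmodXn N (exp_poly N x * exp_poly N y) (exp_poly N (x + y)).
Proof.
move=> k kN; rewrite coefM coef_poly ltnS kN [x + y]addrC exprDn scaler_sumr.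
apply: eq_bigr => i _; have ik : (i <= k)%N by rewrite -ltnS.
rewrite !coef_poly !ltnS (leq_trans ik kN) (leq_trans (leq_subr _ _) kN).
rewrite -scalerAl -scalerAr scalerA [x ^+ _ * _]mulrC -[_ *+ 'C(k, i)]scaler_nat scalerA.
congr (_ *: _); rewrite -(bin_fact ik) !natrM.
by field; rewrite !pnatr_eq0 -!lt0n !fact_gt0 bin_gt0.
Qed.

Lemma exp_poly_sum (I : finType) N (x : I -> A) :
  eqmodXn N (\prod_i exp_poly N (x i)) (exp_poly N (\sum_i x i)).
Proof.
elim/big_rec2: _ => [k kN|i p y _ IH k kN].
  rewrite coef_poly coef1 ltnS kN; case: k {kN} => [|k].
    by rewrite expr0 invr1 scale1r.
  by rewrite expr0n scaler0.
by rewrite (eqmodXnM (fun _ _ => erefl) IH)// exp_polyD.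
Qed.

(** Since sum_n C(n, g) x^n / n! X^n = (x^g / g!) X^g exp(x X), the left side is the coefficient of
    X^a in a product of such series, whose exponentials combine into one. At barycentric
    coordinates, whose sum is 1, this is degree elevation. *)
Lemma multinomial_shift d (a b : nat) (g : 'I_d.+1 -> nat) (x : 'I_d.+1 -> A) :
  (b <= a)%N -> (\sum_k g k = b)%N ->
  \sum_(t in multi_index d a)
    \prod_k (('C(tnth t k, g k)%:R / (tnth t k)`!%:R) *: x k ^+ tnth t k) =
  (a - b)`!%:R^-1 *: (\sum_k x k) ^+ (a - b) *
    \prod_k ((g k)`!%:R^-1 *: x k ^+ g k).
Proof.
move=> ba gb.
rewrite (@sum_multi_index _ _ _ (fun k n => ('C(n, g k)%:R / n`!%:R) *: x k ^+ n)
  (fun k => ((g k)`!%:R^-1 *: x k ^+ g k)%:P * ('X^(g k) * exp_poly a (x k)))).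
  rewrite !big_split/= -rmorph_prod/= prodrXr gb coefCM coefXnM ltnNge ba/=.
  by rewrite exp_poly_sum ?leq_subr// coef_poly ltnS leq_subr mulrC.
move=> k n na; rewrite coefCM coefXnM; case: ltnP => ng.
  by rewrite bin_small// mul0r scale0r mulr0.
rewrite coef_poly ltnS (leq_trans (leq_subr _ _) na).
rewrite -scalerAl -scalerAr scalerA -exprD subnKC//; congr (_ *: _).
rewrite -(bin_fact ng) !natrM.
by field; rewrite !pnatr_eq0 -!lt0n !fact_gt0 bin_gt0.
Qed.

End Multinomial.

(** * Matrices of binomial products indexed by multi-indices *)

Section BinomialMatrices.
Variables (R : realFieldType) (d : nat).

Definition mindex N (i : 'I_(dimP d N)) (k : 'I_d.+1) : nat := tnth (enum_val i) k.

Lemma sum_mindex N (i : 'I_(dimP d N)) : (\sum_k mindex i k)%N = N.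
Proof. exact: sum_multi_indexE (enum_valP i). Qed.

Lemma mindex_inj N (i j : 'I_(dimP d N)) : mindex i =1 mindex j -> i = j.
Proof.
by move=> ij; apply/enum_val_inj/eq_from_tnth => k; exact: val_inj (ij k).
Qed.

(** Both multi-indices have total [N], which leaves no room for a strict inequality. *)
Lemma mindex_le_eq N (i j : 'I_(dimP d N)) :
  (forall k, mindex i k <= mindex j k)%N -> i = j.
Proof.
move=> ij; apply: mindex_inj => k; apply/eqP.
have := leqif_sum (fun k (_ : true) => leqif_eq (ij k)).
by move=> [_]; rewrite !sum_mindex eqxx => /esym/forallP/(_ k).
Qed.

Lemma sum_mindexE (A : nmodType) N (F : d.+1.-tuple 'I_N.+1 -> A) :
  \sum_(i < dimP d N) F (enum_val i) = \sum_(a in multi_index d N) F a.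
Proof. by rewrite [RHS]big_enum_val. Qed.

Definition binmx a b : 'M[R]_(dimP d a, dimP d b) :=
  \matrix_(i, j) \prod_k ('C(mindex i k, mindex j k))%:R.

(** The matrix T of the overview; [gramE] relates it to the Gram matrix. *)
Definition addbinmx a b : 'M[R]_(dimP d a, dimP d b) :=
  \matrix_(i, j) \prod_k ('C(mindex i k + mindex j k, mindex i k))%:R.

(* By Vandermonde, [addbinmx N N] is the sum of the Gram matrices of the vectors
   [prod_k C(alpha_k, h_k)]; those with |h| = N give the identity matrix. *)
Lemma addbinmx_unit N : addbinmx N N \in unitmx.
Proof.
rewrite -row_free_unit; apply: inj_row_free => v vT0.
have : (v *m addbinmx N N *m v^T) 0 0 = 0 by rewrite vT0 mul0mx mxE.
pose w (h : {ffun 'I_d.+1 -> 'I_N.+1}) :=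
  \sum_i v 0 i * \prod_k ('C(mindex i k, h k))%:R.
have -> : (v *m addbinmx N N *m v^T) 0 0 = \sum_h w h ^+ 2.
  rewrite mxE.
  under eq_bigr do rewrite !mxE mulr_suml.
  under [RHS]eq_bigr do rewrite expr2 {1}/w mulr_suml.
  rewrite [RHS]exchange_big [LHS]exchange_big/=; apply: eq_bigr => i _.
  under [RHS]eq_bigr do rewrite /w mulr_sumr.
  rewrite [RHS]exchange_big/=; apply: eq_bigr => j _.
  have -> : addbinmx N N i j = \sum_(h : {ffun 'I_d.+1 -> 'I_N.+1})
      \prod_k ('C(mindex i k, h k) * 'C(mindex j k, h k))%:R.
    rewrite mxE -(bigA_distr_bigA (fun k (n : 'I_N.+1) =>
      ('C(mindex i k, n) * 'C(mindex j k, n))%:R : R)).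
    apply: eq_bigr => k _; rewrite -natr_sum; congr (_%:R).
    have iN : (mindex i k <= N)%N by rewrite -ltnS /mindex ltn_ord.
    rewrite addnC -binomial.Vandermonde (big_ord_widen N.+1 (fun n =>
      'C(mindex j k, n) * 'C(mindex i k, mindex i k - n))%N)//.
    rewrite big_mkcond/=; apply: eq_bigr => n _; rewrite ltnS.
    case: leqP => [ni|ni]; last by rewrite [X in (X * _)%N]bin_small.
    by rewrite bin_sub// mulnC.
  rewrite mulr_sumr mulr_suml; apply: eq_bigr => h _.
  under eq_bigr do rewrite natrM.
  rewrite big_split/=; ring.
(* A vanishing sum of squares in an ordered field forces every [w h] to vanish. *)
move=> /eqP; rewrite psumr_eq0 => [/allP w0|h _]; last first.
  by rewrite sqr_ge0.
have {}w0 h : w h = 0.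
  by apply/eqP; rewrite -sqrf_eq0; apply: w0; rewrite mem_index_enum.
(* Taking [h] to be the multi-index of [j] isolates [v 0 j]: any other [i] has a smaller entry
   somewhere, where the binomial is zero. *)
apply/rowP => j; rewrite mxE -[RHS](w0 [ffun k => tnth (enum_val j) k]) /w.
rewrite (bigD1 j)//= [X in _ * X]big1 => [|k _]; last by rewrite ffunE binn.
rewrite mulr1 big1 ?addr0// => i ij.
have [k ik] : exists k, (mindex i k < mindex j k)%N.
  apply/existsP; apply: contraNT ij; rewrite negb_exists => /forallP ij.
  by apply/eqP/esym/mindex_le_eq => k; rewrite leqNgt.
by rewrite (bigD1 k)//= ffunE bin_small ?mul0r ?mulr0.
Qed.

Lemma addbinmx_decomp N M : exists e : nat -> R,
  addbinmx N (N + M) =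
  \sum_(j < N.+1) e j *: (addbinmx N (N - j) *m (binmx (N + M) (N - j))^T).
Proof.
have [e eM] := inverse_modXn R N M.
exists (fun j => e`_j); apply/matrixP => a b.
rewrite mxE summxE.
pose F k := binpoly R (mindex a k) (mindex b k).
have inner (j : 'I_N.+1) :
    (addbinmx N (N - j) *m (binmx (N + M) (N - j))^T) a b = (\prod_k F k)`_(N - j).
  rewrite mxE -(sum_multi_index (f := fun k n =>
    ('C(mindex a k + n, mindex a k) * 'C(mindex b k, n))%:R)) => [|k n _]; last first.
    exact: coef_binpoly.
  rewrite -sum_mindexE; apply: eq_bigr => c _.
  by rewrite !mxE -big_split/=; apply: eq_bigr => k _; rewrite natrM.
transitivity ((e * \prod_k F k)`_N); last first.
  by rewrite coefM; apply: eq_bigr => j _; rewrite [RHS]mxE inner.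
pose S k := binpoly R (mindex b k) (mindex a k).
have FS : \prod_k F k = (1 + 'X) ^+ M * \prod_k S k.
  (* A single exponent beta_k - alpha_k can be negative, so the symmetry is multiplied out over all
     [k] first and (1 + X)^N is cancelled afterwards. *)
  have : (1 + 'X) ^+ N * \prod_k F k = (1 + 'X) ^+ (N + M) * \prod_k S k.
    rewrite -{1}(sum_mindex a) -(sum_mindex b) -!prodrXr -!big_split/=.
    by apply: eq_bigr => k _; exact: binpoly_sym.
  rewrite exprD -mulrA; apply: mulfI.
  by rewrite expf_neq0// addrC -[1]opprK -polyCN polyXsubC_eq0.
(* Up to degree [N] the factor [e] cancels (1 + X)^M. What remains is the coefficient of X^N in the
   product of the [S k]; the degree bounds of its factors add up to [N], so it is the product of the
   top coefficients. *)
rewrite FS mulrA (eqmodXnM eM (fun _ _ => erefl))// mul1r.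
have [_] := @size_prod_top R _ (mindex a) S (fun k => size_poly _ _).
rewrite sum_mindex => ->; apply: eq_bigr => k _.
by rewrite coef_binpoly binn muln1 addnC -bin_sub ?leq_addl// addnK.
Qed.

End BinomialMatrices.

(** * Integrals over the simplex *)

Local Open Scope classical_set_scope.
Local Open Scope ring_scope.

Section Dirichlet.
Variable R : realType.
Local Notation mu := (@lebesgue_measure R).

(** Induction on [b] is integration by parts, trading a factor c - X for a factor 1 + X until only a
    power of 1 + X is left. *)
Lemma beta_primitive (a b : nat) (c : R) : exists Q : {poly R},
  [/\ Q^`() = (1 + 'X) ^+ a * (c%:P - 'X) ^+ b, Q.[-1] = 0 &
      Q.[c] = (a`! * b`!)%:R / (a + b).+1`!%:R * (1 + c) ^+ (a + b).+1].
Proof.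
have unitE n : (n.+1%:R^-1)%:P * n.+1%:R = 1 :> {poly R}.
  by rewrite -(rmorph_nat polyC) -rmorphM/= mulVf// pnatr_eq0.
have factE n : n`!%:R != 0 :> R by rewrite pnatr_eq0 -lt0n fact_gt0.
elim: b a => [|b IH] a.
  exists (a.+1%:R^-1 *: (1 + 'X) ^+ a.+1); split.
  - rewrite derivZ deriv_exp derivD derivX derivC add0r mul1r/= expr0 mulr1.
    by rewrite -mul_polyC -(mulr_natl (_ ^+ _)) mulrA unitE mul1r.
  - have v0 : (1 + 'X : {poly R}).[-1] = 0 by rewrite hornerD hornerX hornerC; ring.
   by rewrite hornerZ horner_exp v0 exprS mul0r mulr0.
  - rewrite fact0 muln1 addn0 factS natrM !hornerE; congr (_ * _).
    by rewrite invfM mulrCA divff ?mulr1.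
have [Q [dQ Q1 Qc]] := IH a.+1.
exists (a.+1%:R^-1 *: ((1 + 'X) ^+ a.+1 * (c%:P - 'X) ^+ b.+1 + b.+1%:R *: Q)); split.
- rewrite derivZ derivD derivM derivZ dQ !deriv_exp derivB derivD derivX !derivC.
  rewrite add0r sub0r mul1r/= -!mul_polyC rmorph_nat.
  set y := 1 + 'X; set z := c%:P - 'X.
  transitivity ((a.+1%:R^-1)%:P * a.+1%:R * (y ^+ a * z ^+ b.+1)); first by ring.
  by rewrite unitE mul1r.
- have v0 : (1 + 'X : {poly R}).[-1] = 0 by rewrite hornerD hornerX hornerC; ring.
  by rewrite hornerZ hornerD hornerM hornerZ Q1 horner_exp v0 exprS !(mul0r,mulr0,addr0).
- have vc : (c%:P - 'X).[c] = 0 by rewrite hornerD hornerN hornerX hornerC subrr.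
  rewrite hornerZ hornerD hornerM hornerZ Qc (horner_exp (c%:P - 'X)) vc.
  rewrite (exprS 0) !(mul0r,mulr0,add0r) addSnnS mulrCA !mulrA.
  congr (_ / _ * _); rewrite !factS !natrM.
  have : a.+1%:R != 0 :> R by rewrite pnatr_eq0.
  by move: a.+1%:R => u u0; field.
Qed.

Lemma beta_integral (a b : nat) (c : R) : -1 <= c ->
  (\int[mu]_(x in `[(-1)%R, c]) ((1 + x) ^+ a * (c - x) ^+ b)%:E)%E =
  ((a`! * b`!)%:R / (a + b).+1`!%:R * (1 + c) ^+ (a + b).+1)%:E.
Proof.
(* The interval reduced to a point is treated apart, as the fundamental theorem is applied with -1 <
   c. *)
rewrite le_eqVlt => /predU1P[<-|c1].
  by rewrite set_itv1 integral_set1 subrr exprS mul0r mulr0.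
have [Q [dQ Q1 Qc]] := beta_primitive a b c.
under eq_integral => x _.
  have -> : (1 + x) ^+ a * (c - x) ^+ b = Q^`().[x] by rewrite dQ !hornerE.
  over.
rewrite (@continuous_FTC2 _ _ (horner Q))// ?Q1 ?Qc ?sube0//.
- by apply: continuous_subspaceT; exact: continuous_horner.
- split; first by move=> x _; exact: derivable_horner.
    by apply: cvg_at_right_filter; exact: continuous_horner.
  by apply: cvg_at_left_filter; exact: continuous_horner.
- by move=> x _; rewrite derive1E; apply: derive_val; exact: is_derive_poly.
Qed.

Local Notation T := (measurableTypeR R).

(** In the coordinates 1 + x_i this is a standard simplex of size [s]. A free [s] makes its slices
    corners again; s = 2 gives the reference simplex. *)
Definition corner n (s : R) : set (n.-tuple T) :=
  [set x | (forall i, -1 <= (tnth x i : R)) /\ \sum_i (1 + (tnth x i : R)) <= s].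

(** Unnormalised Dirichlet density. The slack carries its own exponent [m], which slicing leaves
    unchanged. *)
Definition dirichlet_density n (g : 'I_n -> nat) m (s : R) (x : n.-tuple T) : R :=
  \prod_i (1 + (tnth x i : R)) ^+ g i * (s - \sum_i (1 + (tnth x i : R))) ^+ m.

Lemma measurable_sum_tnth n :
  measurable_fun setT (fun x : n.-tuple T => \sum_i (1 + (tnth x i : R))).
Proof.
apply: measurable_sum => i; apply: measurable_funD => //.
exact: measurable_tnth.
Qed.

Lemma measurable_corner n s : measurable (@corner n s).
Proof.
have -> : @corner n s = (\bigcap_(i in [set: 'I_n]) [set x | -1 <= (tnth x i : R)])
   `&` [set x | \sum_i (1 + (tnth x i : R)) <= s].
  by apply/seteqP; split => x [x1 xs]; split => // i; [move=> _|]; exact: x1.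
apply: measurableI.
  apply: fin_bigcap_measurable => // i _.
  rewrite -[X in measurable X]setTI; apply: measurable_fun_le => //.
  exact: measurable_tnth.
rewrite -[X in measurable X]setTI; apply: measurable_fun_le => //.
exact: measurable_sum_tnth.
Qed.

Lemma measurable_dirichlet_density n (g : 'I_n -> nat) m s :
  measurable_fun setT (dirichlet_density g m s).
Proof.
apply: measurable_funM.
  apply: measurable_prod => i _; apply: measurable_funX.
  by apply: measurable_funD => //; exact: measurable_tnth.
apply: measurable_funX; apply: measurable_funB => //.
exact: measurable_sum_tnth.
Qed.

Lemma dirichlet_density_ge0 n (g : 'I_n -> nat) m s x : corner s x ->
  0 <= dirichlet_density g m s x.
Proof.
move=> [x1 xs]; apply: mulr_ge0; last by rewrite exprn_ge0// subr_ge0.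
by apply: prodr_ge0 => i _; rewrite exprn_ge0// -lerBlDl sub0r.
Qed.

(** Fixing the first coordinate uses up 1 + x of the size [s]. The bound s - 1 on [x] says that the
    rest is nonnegative and turns the outer domain of integration into an interval. *)
Lemma corner_cons n s (x : T) (y : n.-tuple T) :
  corner s (tuple_cons (x, y)) <->
  -1 <= (x : R) <= s - 1 /\ corner (s - 1 - (x : R)) y.
Proof.
have tS i : tnth (tuple_cons (x, y)) (lift ord0 i) = tnth y i by rewrite tnthS.
have t0 : tnth (tuple_cons (x, y)) ord0 = x by [].
rewrite /corner/= big_ord_recl/=; under eq_bigr do rewrite tS.
split=> [[x1 xs]|[/andP[x1 _] [y1 ys]]].
  have y1 i : -1 <= (tnth y i : R) by rewrite -tS.
  have := x1 ord0; rewrite t0 => x0.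
  have : 0 <= \sum_i (1 + (tnth y i : R)).
    by apply: sumr_ge0 => i _; rewrite -lerBlDl sub0r.
  by move: xs; rewrite t0 => xs sum0; split; [apply/andP; split|split=> //]; lra.
split; last by rewrite t0; lra.
by move=> i; case: (unliftP ord0 i) => [j ->|->]; rewrite ?tS// t0.
Qed.

Lemma dirichlet_density_cons n (g : 'I_n.+1 -> nat) m s (x : T) (y : n.-tuple T) :
  dirichlet_density g m s (tuple_cons (x, y)) =
  (1 + (x : R)) ^+ g ord0 *
    dirichlet_density (g \o lift ord0) m (s - 1 - (x : R)) y.
Proof.
have tS i : tnth (tuple_cons (x, y)) (lift ord0 i) = tnth y i by rewrite tnthS.
have t0 : tnth (tuple_cons (x, y)) ord0 = x by [].
rewrite /dirichlet_density !big_ord_recl t0.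
rewrite -mulrA; congr (_ * (_ * _ ^+ _)).
  by apply: eq_bigr => i _; rewrite tS.
rewrite (eq_bigr (fun i => 1 + (tnth y i : R))) => [|i _]; last by rewrite tS.
by rewrite !opprD !addrA.
Qed.

(** Induction on [n] by Tonelli: integrating over a slice leaves a power of its size, and the first
    coordinate then contributes a beta integral. For s < 0 the corner is empty. *)
Lemma dirichlet_integral n (g : 'I_n -> nat) m s :
  (\int[@lebesgue_tuple R n]_(x in corner s) (dirichlet_density g m s x)%:E)%E =
  (if 0 <= s then
     (\prod_i (g i)`! * m`!)%:R / (\sum_i g i + m + n)`!%:R * s ^+ (\sum_i g i + m + n)
   else 0)%:E.
Proof.
elim: n g m s => [|n IH] g m s.
  rewrite /= integral_dirac//=; [|exact: measurable_corner|]; last first.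
    apply/measurable_EFinP; apply: measurable_funTS.
    exact: (measurable_dirichlet_density g m s).
  rewrite diracE /dirichlet_density !big_ord0 addn0 add0n !mul1n mul1r subr0.
  rewrite divff ?pnatr_eq0 -?lt0n ?fact_gt0// mul1r.
  have -> : ([tuple] \in @corner 0 s) = (0 <= s).
    apply/idP/idP; rewrite inE /corner/= big_ord0; first by case.
    by move=> s0; split => // -[].
  by case: ifP => _; rewrite ?mul1e ?mul0e.
pose g' := g \o lift ord0; pose K := (\sum_i g' i + m + n)%N.
pose C : R := (\prod_i (g' i)`! * m`!)%:R / K`!%:R.
pose f t := (dirichlet_density g m s t)%:E.
have mf : measurable_fun setT f.
  by apply/measurable_EFinP; exact: measurable_dirichlet_density.
(* In dimension n + 1 [lebesgue_tuple] unfolds to this pushforward; exposing it as a measure allows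
   the change of variables along [tuple_cons]. *)
rewrite (@eq_measure_integral _ _ _ _
  (pushforward (mu \x @lebesgue_tuple R n)%E (@tuple_cons R n)))//.
  exact: measurable_tuple_cons.
move=> mcons; rewrite ge0_integral_pushforward//=; first last.
- by move=> t; rewrite inE => /(dirichlet_density_ge0 g m); rewrite lee_fin.
- exact: measurable_funTS.
- exact: measurable_corner.
rewrite integral_mkcond fubini_tonelli1; first last.
- move=> t; rewrite patchE; case: ifPn => //; rewrite inE => ct.
  by rewrite lee_fin; exact: dirichlet_density_ge0 ct.
- apply/(measurable_restrictT _ _).1.
    by rewrite -[X in measurable X]setTI; apply: mcons => //; exact: measurable_corner.
  by apply: measurable_funTS; exact: (measurableT_comp mf mcons).
(* Slices over points outside this interval are empty; over the others the induction hypothesis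
   gives [C] times the [K]-th power of the slice size s - 1 - x. *)
transitivity (\int[mu]_(x in `[(-1)%R, (s - 1)%R])
    (C%:E * ((1 + x) ^+ g ord0 * (s - 1 - x) ^+ K)%:E))%E.
  rewrite [RHS]integral_mkcond; apply: eq_integral => x _.
  rewrite /fubini_F patchE; case: ifPn; last first.
    rewrite notin_setE/= in_itv/= => xs; apply: integral0_eq => y _.
    by rewrite patchE ifF//; apply/negbTE; rewrite notin_setE => /corner_cons[].
  rewrite inE/= in_itv/= => xs; have [x1 x2] := andP xs.
  transitivity (\int[@lebesgue_tuple R n]_(y in corner (s - 1 - x))
      (((1 + x) ^+ g ord0)%:E * (dirichlet_density g' m (s - 1 - x) y)%:E))%E.
    rewrite [RHS]integral_mkcond; apply: eq_integral => y _.
    rewrite !patchE dirichlet_density_cons -EFinM; congr (if _ then _ else _).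
    by apply/idP/idP; rewrite !inE => cy; [have /corner_cons[] := cy|apply/corner_cons].
  rewrite ge0_integralZl_EFin//.
  - rewrite IH subr_ge0 x2 -!EFinM; congr (_%:E); rewrite -/K -/C; ring.
  - exact: measurable_corner.
  - by move=> y /(dirichlet_density_ge0 g' m); rewrite lee_fin.
  - by apply/measurable_EFinP; apply: measurable_funTS;
    exact: measurable_dirichlet_density.
  - by rewrite exprn_ge0// -lerBlDl sub0r.
rewrite ge0_integralZl_EFin//; first last.
- by rewrite divr_ge0.
- apply/measurable_EFinP; apply: measurable_funTS; apply: measurable_funM.
    by apply: measurable_funX; apply: measurable_funD.
  by apply: measurable_funX; apply: measurable_funB.
- move=> x/=; rewrite in_itv/= => /andP[x1 x2].
  rewrite lee_fin mulr_ge0 ?exprn_ge0//; lra.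
case: ifPn => [s0|]; last first.
  rewrite -ltNge => s0; rewrite set_itv_ge ?integral_set0 ?mule0//.
  by rewrite bnd_simp -ltNge; lra.
rewrite beta_integral; last by lra.
rewrite -EFinM; congr (_%:E).
rewrite /C !big_ord_recl/=.
have -> : (g ord0 + \sum_(i < n) g (lift ord0 i) + m + n.+1 = (g ord0 + K).+1)%N.
  by rewrite /K /g'/=; lia.
have -> : 1 + (s - 1) = s by ring.
rewrite mulrA; congr (_ * _).
have K0 : K`!%:R != 0 :> R by rewrite pnatr_eq0 -lt0n fact_gt0.
have : ((g ord0 + K).+1)`!%:R != 0 :> R by rewrite pnatr_eq0 -lt0n fact_gt0.
move: (_.+1)`! K`! K0 => v u u0 v0; rewrite !natrM.
by field; rewrite u0 v0.
Qed.
End Dirichlet.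

(** * Bernstein polynomials *)

Section Bernstein.
Variables (R : realType) (d : nat).
Local Notation poly := (mpoly d R).
Local Notation lam := (@barycentric R d).

Lemma sum_barycentric : \sum_k lam k = 1.
Proof.
rewrite big_ord_recl /barycentric unlift_none.
under [X in _ + X]eq_bigr do rewrite liftK.
by rewrite subrK.
Qed.

Lemma bernsteinE N (i : 'I_(dimP d N)) : bernstein R (enum_val i) =
  N`!%:R *: \prod_k ((mindex i k)`!%:R^-1 *: lam k ^+ mindex i k).
Proof. by rewrite /bernstein scaler_prod prodfV scalerA. Qed.

Lemma bernstein_formD N (c c' : 'cV[R]_(dimP d N)) :
  bernstein_form (c + c') = bernstein_form c + bernstein_form c'.
Proof. by rewrite -big_split; apply: eq_bigr => i _; rewrite mxE scalerDl. Qed.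

Lemma bernstein_formZ N a (c : 'cV[R]_(dimP d N)) :
  bernstein_form (a *: c) = a *: bernstein_form c.
Proof. by rewrite scaler_sumr; apply: eq_bigr => i _; rewrite mxE scalerA. Qed.

Definition bernstein_span N (p : poly) :=
  exists c : 'cV[R]_(dimP d N), p = bernstein_form c.

Lemma bernstein_span_lin N a p q :
  bernstein_span N p -> bernstein_span N q -> bernstein_span N (a *: p + q).
Proof.
move=> [c ->] [c' ->]; exists (a *: c + c').
by rewrite bernstein_formD bernstein_formZ.
Qed.

Lemma bernstein_span0 N : bernstein_span N 0.
Proof. by exists 0; rewrite /bernstein_form big1// => i _; rewrite mxE scale0r. Qed.

Lemma bernstein_spanZ N a p : bernstein_span N p -> bernstein_span N (a *: p).
Proof.
by move=> /(bernstein_span_lin a) /(_ (bernstein_span0 N)); rewrite addr0.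
Qed.

Lemma bernstein_span_sum N I (s : seq I) (P : pred I) (F : I -> poly) :
  (forall i, P i -> bernstein_span N (F i)) ->
  bernstein_span N (\sum_(i <- s | P i) F i).
Proof.
move=> FN; elim/big_rec: _ => [|i p Pi pN]; first exact: bernstein_span0.
by rewrite -[F i]scale1r; apply: bernstein_span_lin => //; exact: FN.
Qed.

Lemma bernstein_span_bernstein N (i : 'I_(dimP d N)) :
  bernstein_span N (bernstein R (enum_val i)).
Proof.
exists (delta_mx i 0); rewrite /bernstein_form (bigD1 i)//= mxE !eqxx scale1r.
by rewrite big1 ?addr0// => j /negbTE ji; rewrite mxE ji scale0r.
Qed.

Lemma bernstein_span_monomial N (a : 'I_d.+1 -> nat) : (\sum_k a k = N)%N ->
  bernstein_span N (\prod_k lam k ^+ a k).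
Proof.
move=> aN.
have aleN k : (a k < N.+1)%N by rewrite ltnS -aN (bigD1 k)//= leq_addr.
pose t := [tuple Ordinal (aleN k) | k < d.+1].
have tM : t \in multi_index d N.
  rewrite inE big_tuple; apply/eqP; rewrite -[RHS]aN.
  by apply: eq_bigr => k _; rewrite tnth_mktuple.
have := bernstein_span_bernstein (enum_rank_in tM t).
rewrite enum_rankK_in// => /(bernstein_spanZ (N`!%:R / \prod_k (a k)`!%:R)^-1).
rewrite /bernstein scalerA.
have -> : \prod_k (tnth t k)`!%:R = \prod_k (a k)`!%:R :> R.
  by apply: eq_bigr => k _; rewrite tnth_mktuple.
have -> : \prod_k lam k ^+ tnth t k = \prod_k lam k ^+ a k.
  by apply: eq_bigr => k _; rewrite tnth_mktuple.
rewrite mulVf ?scale1r// mulf_neq0 ?invr_eq0 ?pnatr_eq0 -?lt0n ?fact_gt0//.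
by apply/prodf_neq0 => k _; rewrite pnatr_eq0 -lt0n fact_gt0.
Qed.

Lemma bernstein_span_barycentric N k p :
  bernstein_span N p -> bernstein_span N.+1 (lam k * p).
Proof.
move=> [c ->]; rewrite mulr_sumr; apply: bernstein_span_sum => i _.
rewrite -scalerAr /bernstein -scalerAr; do 2 apply: bernstein_spanZ.
have -> : lam k * \prod_j lam j ^+ tnth (enum_val i) j =
    \prod_j lam j ^+ ((j == k) + mindex i j)%N.
  under [RHS]eq_bigr do rewrite exprD.
  rewrite big_split/=; congr (_ * _); rewrite (bigD1 k)//= eqxx expr1.
  by rewrite big1 ?mulr1// => j /negbTE ->.
apply: bernstein_span_monomial; rewrite big_split/= sum_mindex.
by rewrite (bigD1 k)//= eqxx big1 ?addn0// => j /negbTE ->.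
Qed.

(** Partition of unity: p is the sum of the products lambda_k p. *)
Lemma bernstein_spanS N p : bernstein_span N p -> bernstein_span N.+1 p.
Proof.
move=> pN; rewrite -[p]mul1r -sum_barycentric mulr_suml.
by apply: bernstein_span_sum => k _; exact: bernstein_span_barycentric.
Qed.

Lemma bernstein_span1 N : bernstein_span N 1.
Proof.
elim: N => [|N]; last exact: bernstein_spanS.
have := @bernstein_span_monomial 0 (fun=> 0%N).
rewrite [X in (X = _)%N -> _]big1// => /(_ erefl).
by rewrite (eq_bigr (fun=> 1)) => [|k _]; [rewrite big1_eq|rewrite expr0].
Qed.

(** Each variable is x_i = 2 lambda_i - 1. *)
Lemma bernstein_spanXU N i p :
  bernstein_span N p -> bernstein_span N.+1 (mpolyX R (mnm1 i) * p).
Proof.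
move=> pN.
have -> : mpolyX R (mnm1 i) * p = 2 *: (lam (lift ord0 i) * p) + (-1) *: p.
  rewrite /barycentric liftK -scalerAl scalerA divff ?pnatr_eq0// scale1r.
  by rewrite scaleN1r mulrDl mul1r addrAC subrr add0r.
apply: bernstein_span_lin; first exact: bernstein_span_barycentric.
by apply: bernstein_spanZ; exact: bernstein_spanS.
Qed.

Lemma bernstein_spanX N m : (mdeg m <= N)%N -> bernstein_span N (mpolyX R m).
Proof.
elim: N m => [|N IH] m mN.
  have /eqP : mdeg m == 0%N by rewrite -leqn0.
  by move/eqP; rewrite mdeg_eq0 => /eqP ->; rewrite mpolyX0; exact: bernstein_span1.
have [/forallP m0|] := boolP [forall i, m i == 0%N].
  have -> : m = mnm0 by apply/mnmP => i; rewrite mnm0E; exact/eqP.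
  by rewrite mpolyX0; exact: bernstein_span1.
rewrite negb_forall => /existsP[i mi].
have im : lem (mnm1 i) m by rewrite lep1mP.
rewrite -(submK im) mpolyXD mulrC; apply/bernstein_spanXU/IH.
by move: mN; rewrite -{1}(submK im) mdegD mdeg1 addn1.
Qed.

Lemma poly_space_lin N a (p q : poly) :
  poly_space N p -> poly_space N q -> poly_space N (a *: p + q).
Proof.
move=> pN qN; apply: leq_trans (msizeD_le _ _) _.
by rewrite geq_max (leq_trans (msizeZ_le _ _) pN) qN.
Qed.

Lemma poly_space_sum N I (s : seq I) (F : I -> R) (p : I -> poly) :
  (forall i, poly_space N (p i)) -> poly_space N (\sum_(i <- s) F i *: p i).
Proof.
move=> FN; elim/big_rec: _ => [|i q _ qN]; first by rewrite /poly_space/= msize0.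
exact: poly_space_lin.
Qed.

Lemma poly_spaceM a b (p q : poly) :
  poly_space a p -> poly_space b q -> poly_space (a + b) (p * q).
Proof.
rewrite /poly_space/= => pa qb.
have [->|p0] := eqVneq p 0; first by rewrite mul0r msize0.
have [->|q0] := eqVneq q 0; first by rewrite mulr0 msize0.
by rewrite msizeM// -subn1 leq_subLR (leq_trans (leq_add pa qb))// addSn addnS.
Qed.

Lemma poly_space1 N : poly_space N (1 : poly).
Proof. by rewrite /poly_space/= msize1. Qed.

Lemma poly_space_barycentric k : poly_space 1 (lam k).
Proof.
have lamS i : poly_space 1 (lam (lift ord0 i)).
  rewrite /barycentric liftK -[X in poly_space _ X]addr0.
  apply: poly_space_lin; last by rewrite /poly_space/= msize0.
  rewrite addrC -[mpolyX _ _]scale1r; apply: poly_space_lin; last exact: poly_space1.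
  by rewrite /poly_space/= msizeX mdeg1.
case: (unliftP ord0 k) => [i ->//|->].
have -> : lam ord0 = (-1) *: (\sum_i 1 *: lam (lift ord0 i)) + 1.
  by rewrite scaleN1r -scaler_sumr scale1r addrC -sum_barycentric big_ord_recl addrK.
by apply: poly_space_lin; [exact: poly_space_sum|exact: poly_space1].
Qed.

Lemma poly_space_bernstein N (i : 'I_(dimP d N)) :
  poly_space N (bernstein R (enum_val i)).
Proof.
rewrite /bernstein -[X in poly_space _ X]addr0.
apply: poly_space_lin; last by rewrite /poly_space/= msize0.
rewrite -{1}(sum_mindex i); elim/big_rec2: _ => [|k p n _ pn]; first exact: poly_space1.
apply: poly_spaceM => //; rewrite /mindex.
elim: (nat_of_ord _) => [|m IH]; first exact: poly_space1.
by rewrite exprS -add1n; apply: poly_spaceM => //; exact: poly_space_barycentric.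
Qed.

(** One direction counts degrees; the other reduces to monomials, built up one variable at a time by
    [bernstein_spanX]. *)
Lemma bernstein_spanP N p : bernstein_span N p <-> poly_space N p.
Proof.
split; first by case=> c ->; apply: poly_space_sum => i; exact: poly_space_bernstein.
rewrite /poly_space/= => pN; rewrite [p]mpolyE.
rewrite big_seq; apply: bernstein_span_sum => m mp.
apply/bernstein_spanZ/bernstein_spanX.
by rewrite -ltnS (leq_trans _ pN)// msize_mdeg_lt.
Qed.

(** Closed form of the degree elevation matrix; [elevation_mxE] identifies the two. *)
Definition elev a b : 'M[R]_(dimP d a, dimP d b) := 'C(a, b)%:R^-1 *: binmx R d a b.

Lemma bernstein_form_elev a b (c : 'cV[R]_(dimP d b)) : (b <= a)%N ->
  bernstein_form c = bernstein_form (elev a b *m c).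
Proof.
move=> ba; rewrite /bernstein_form.
transitivity (\sum_i \sum_j (c j 0 * ('C(a, b)%:R^-1 * binmx R d a b i j)) *:
   bernstein R (enum_val i)); last first.
  apply: eq_bigr => i _; rewrite -scaler_suml mxE; congr (_ *: _).
  by apply: eq_bigr => j _; rewrite [X in _ = X * _]mxE mulrC.
rewrite exchange_big/=; apply: eq_bigr => j _.
under eq_bigr do rewrite -scalerA; rewrite -scaler_sumr; congr (_ *: _).
have := multinomial_shift lam ba (sum_mindex j).
rewrite sum_barycentric expr1n -scalerAl mul1r.
(* This factor equals a! / C(a, b): it turns the right side into a Bernstein polynomial of degree
   [b] and the left side into the elevated sum. *)
move=> /(congr1 (fun p => (b`!%:R * (a - b)`!%:R) *: p)).
rewrite scalerA mulfK ?pnatr_eq0 -?lt0n ?fact_gt0// -bernsteinE => <-.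
rewrite -sum_mindexE scaler_sumr; apply: eq_bigr => i _.
rewrite bernsteinE mxE (eq_bigr (fun k => 'C(mindex i k, mindex j k)%:R *:
  ((mindex i k)`!%:R^-1 *: lam k ^+ mindex i k))) => [|k _]; last by rewrite scalerA.
rewrite scaler_prod !scalerA; congr (_ *: _).
rewrite [RHS]mulrAC; congr (_ * _).
by rewrite -(bin_fact ba) natrM mulKf ?natrM// pnatr_eq0 -lt0n bin_gt0.
Qed.

End Bernstein.

(** * Gram matrices of the Bernstein bases *)

Section Gram.
Variables (R : realType) (d : nat).
Local Notation poly := (mpoly d R).
Local Notation lam := (@barycentric R d).
Local Notation S := (@simplex R d).
Local Notation mu := (@lebesgue_tuple R d).

Lemma simplexE : S = corner 2.
Proof.
apply/seteqP; split=> x [x1 xs]; split=> //; move: xs;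
  by rewrite big_split/= sumr_const card_ord lerBrDl.
Qed.

Lemma measurable_simplex : measurable S.
Proof. by rewrite simplexE; exact: measurable_corner. Qed.

Definition barycentric_monomial (a : 'I_d.+1 -> nat) : poly := \prod_k lam k ^+ a k.

Lemma meval_barycentricS x i :
  meval (tnth x) (lam (lift ord0 i)) = 2^-1 * (1 + (tnth x i : R)).
Proof. by rewrite /barycentric liftK mevalZ mevalD meval1 mevalXU. Qed.

Lemma meval_barycentric0 x :
  meval (tnth x) (lam ord0) = 2^-1 * (2 - \sum_i (1 + (tnth x i : R))).
Proof.
rewrite /barycentric unlift_none mevalB meval1 rmorph_sum/= mulrBr mulVf ?pnatr_eq0//.
congr (_ - _); rewrite mulr_sumr; apply: eq_bigr => i _.
by rewrite mevalZ mevalD meval1 mevalXU.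
Qed.

(** Every barycentric coordinate is half of a factor of the density at size 2, lambda_0 being half
    of the slack. *)
Lemma meval_barycentric_monomial a x : meval (tnth x) (barycentric_monomial a) =
  2^-1 ^+ (\sum_k a k) * dirichlet_density (a \o lift ord0) (a ord0) 2 x.
Proof.
rewrite /barycentric_monomial rmorph_prod/= !big_ord_recl rmorphXn/=.
rewrite (eq_bigr (fun i => 2^-1 ^+ a (lift ord0 i) *
  (1 + (tnth x i : R)) ^+ a (lift ord0 i))) => [|i _]; last first.
  by rewrite rmorphXn/= meval_barycentricS exprMn.
rewrite big_split/= prodrXr meval_barycentric0 exprMn exprD /dirichlet_density/=; ring.
Qed.

Lemma barycentric_monomial_ge0 a x : S x -> 0 <= meval (tnth x) (barycentric_monomial a).
Proof.
rewrite simplexE meval_barycentric_monomial => Sx.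
rewrite mulr_ge0 ?exprn_ge0 ?invr_ge0//.
exact: dirichlet_density_ge0 Sx.
Qed.

Lemma measurable_barycentric_monomial a :
  measurable_fun setT
    (fun x : d.-tuple (measurableTypeR R) => meval (tnth x) (barycentric_monomial a)).
Proof.
under eq_fun do rewrite meval_barycentric_monomial.
by apply: measurable_funM => //; exact: measurable_dirichlet_density.
Qed.

(** The Dirichlet integral at size 2 yields 2^(|a| + d), of which the |a| halves from the
    barycentric coordinates leave 2^d. *)
Lemma integral_barycentric_monomial a :
  (\int[mu]_(x in S) (meval (tnth x) (barycentric_monomial a))%:E)%E =
  ((\prod_k (a k)`!)%:R * (2 ^+ d / (\sum_k a k + d)`!%:R))%:E.
Proof.
under eq_integral do rewrite meval_barycentric_monomial EFinM.
rewrite simplexE ge0_integralZl_EFin//.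
- rewrite dirichlet_integral ler0n -EFinM; congr (_%:E).
  rewrite !big_ord_recl/= [(\sum_(i < d) _ + _)%N]addnC [(\prod_(i < d) _ * _)%N]mulnC.
  move: (_ + \sum_(i < d) _)%N (_ * _)%N => s P; rewrite exprVn exprD.
  have : 2 ^+ s != 0 :> R by rewrite expf_neq0// pnatr_eq0.
  have : (s + d)`!%:R != 0 :> R by rewrite pnatr_eq0 -lt0n fact_gt0.
  by move: (2 ^+ s) (_`!%:R) => u v v0 u0; field; rewrite ?u0 ?v0.
- exact: measurable_corner.
- by move=> x /dirichlet_density_ge0 ?; rewrite lee_fin.
- by apply/measurable_EFinP; apply: measurable_funTS;
    exact: measurable_dirichlet_density.
Qed.

(** Expanding [p] in a Bernstein basis reduces this to barycentric monomials, which are nonnegative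
    on the simplex and have a finite integral. *)
Lemma integrable_meval p : mu.-integrable S (EFin \o (fun x => meval (tnth x) p)).
Proof.
have [c ->] : bernstein_span (msize p) p by apply/bernstein_spanP; rewrite /poly_space/=.
rewrite /bernstein_form.
under eq_fun do rewrite rmorph_sum/=.
rewrite (_ : EFin \o _ = fun x => (\sum_(i < dimP d (msize p))
   ((meval (tnth x) (c i 0 *: bernstein R (enum_val i)))%:E))%E); last first.
  by apply/funext => x/=; rewrite -sumEFin.
apply: integrable_sum => //; first exact: measurable_simplex.
move=> i _; rewrite /bernstein.
under eq_fun do rewrite scalerA mevalZ EFinM.
apply: integrableZl; first exact: measurable_simplex.
rewrite -/(barycentric_monomial (fun k => tnth (enum_val i) k)).
apply/integrableP; split.
  by apply/measurable_EFinP; apply: measurable_funTS;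
    exact: measurable_barycentric_monomial.
rewrite (eq_integral (fun x : d.-tuple (measurableTypeR R) => (meval (tnth x)
    (barycentric_monomial (fun k => tnth (enum_val i) k)))%:E)) => [|x].
  by rewrite integral_barycentric_monomial ltry.
by rewrite inE => /barycentric_monomial_ge0 ?; rewrite gee0_abs// lee_fin.
Qed.

Definition simplex_int (p : poly) : R := \int[mu]_(x in S) meval (tnth x) p.

Lemma dotL2E p q : dotL2 p q = simplex_int (p * q).
Proof. by apply: eq_Rintegral => x _; rewrite mevalM. Qed.

Lemma simplex_int_lin a p q :
  simplex_int (a *: p + q) = a * simplex_int p + simplex_int q.
Proof.
rewrite /simplex_int; under eq_Rintegral do rewrite mevalD mevalZ.
have mS := measurable_simplex.
rewrite RintegralD ?RintegralZl//; try exact: integrable_meval.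
exact: (integrableZl mS a (integrable_meval p)).
Qed.

Lemma simplex_int0 : simplex_int 0 = 0.
Proof.
have := simplex_int_lin (-1) 0 0.
by rewrite scaler0 add0r mulN1r addNr.
Qed.

Lemma simplex_intZ a p : simplex_int (a *: p) = a * simplex_int p.
Proof. by rewrite -[a *: p]addr0 simplex_int_lin simplex_int0 addr0. Qed.

Lemma simplex_int_sum I (s : seq I) (F : I -> R) (p : I -> poly) :
  simplex_int (\sum_(i <- s) F i *: p i) = \sum_(i <- s) F i * simplex_int (p i).
Proof.
elim/big_rec2: _ => [|i y q _ <-]; first exact: simplex_int0.
by rewrite simplex_int_lin.
Qed.

Lemma simplex_int_monomial a : simplex_int (barycentric_monomial a) =
  \prod_k (a k)`!%:R * (2 ^+ d / (\sum_k a k + d)`!%:R).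
Proof. by rewrite /simplex_int /Rintegral integral_barycentric_monomial natr_prod. Qed.

Definition gram N K : 'M[R]_(dimP d N, dimP d K) :=
  \matrix_(i, j) dotL2 (bernstein R (enum_val i)) (bernstein R (enum_val j)).

Lemma dotL2_bernstein_form N K (c : 'cV_(dimP d N)) (c' : 'cV_(dimP d K)) :
  dotL2 (bernstein_form c) (bernstein_form c') = (c^T *m gram N K *m c') 0 0.
Proof.
rewrite dotL2E /bernstein_form mulr_suml.
under eq_bigr do rewrite -scalerAl.
rewrite simplex_int_sum -mulmxA mxE; apply: eq_bigr => i _.
rewrite [in RHS]mxE; congr (_ * _); rewrite mulr_sumr.
under eq_bigr do rewrite -scalerAr.
rewrite simplex_int_sum mxE; apply: eq_bigr => j _.
by rewrite !mxE dotL2E mulrC.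
Qed.

(** A product of two Bernstein polynomials is a scaled barycentric monomial, and its factorials
    assemble into the binomials C(alpha_k + beta_k, alpha_k). *)
Lemma gramE N K :
  gram N K = (N`!%:R * K`!%:R * (2 ^+ d / (N + K + d)`!%:R)) *: addbinmx R d N K.
Proof.
apply/matrixP => i j; rewrite !mxE !bernsteinE dotL2E.
rewrite -scalerAl -scalerAr scalerA -big_split/=.
rewrite (eq_bigr (fun k => ((mindex i k)`!%:R^-1 * (mindex j k)`!%:R^-1) *:
   lam k ^+ (mindex i k + mindex j k)%N)) => [|k _]; last first.
  by rewrite -scalerAl -scalerAr scalerA exprD.
rewrite scaler_prod scalerA simplex_intZ.
rewrite (simplex_int_monomial (fun k => mindex i k + mindex j k)%N).
have -> : (\sum_k (mindex i k + mindex j k) = N + K)%N by rewrite big_split/= !sum_mindex.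
have -> : \prod_k 'C(mindex i k + mindex j k, mindex i k)%:R =
    \prod_k ((mindex i k)`!%:R^-1 * (mindex j k)`!%:R^-1) *
    \prod_k (mindex i k + mindex j k)`!%:R :> R.
  rewrite -big_split/=; apply: eq_bigr => k _.
  rewrite -(bin_fact (leq_addr (mindex j k) (mindex i k))) addKn !natrM.
  by field; rewrite !pnatr_eq0 -!lt0n !fact_gt0.
by rewrite [X in _ * X = _]mulrC mulrACA.
Qed.

End Gram.

(** * Characterisation of the elevation and projection matrices *)

Section Projection.
Variables (R : realType) (d : nat).

Lemma bilinear_mx_inj m n (A B : 'M[R]_(m, n)) :
  (forall (c : 'cV_m) (c' : 'cV_n), (c^T *m A *m c') 0 0 = (c^T *m B *m c') 0 0) ->
  A = B.
Proof.
move=> AB; apply/matrixP => i j.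
have := AB (delta_mx i 0) (delta_mx j 0).
by rewrite !trmx_delta -!rowE -!colE !mxE.
Qed.

Lemma mulmx_cV_inj m n (A B : 'M[R]_(m, n)) :
  (forall c : 'cV_n, A *m c = B *m c) -> A = B.
Proof. by move=> AB; apply: bilinear_mx_inj => c c'; rewrite -!mulmxA AB. Qed.

Definition gram_const N K : R := N`!%:R * K`!%:R * (2 ^+ d / (N + K + d)`!%:R).

Lemma gram_const_neq0 N K : gram_const N K != 0.
Proof.
by rewrite !mulf_neq0 ?invr_eq0 ?expf_neq0 ?pnatr_eq0 -?lt0n ?fact_gt0.
Qed.

Lemma gram_unit N : gram R d N N \in unitmx.
Proof. by rewrite gramE unitmxZ ?addbinmx_unit// unitfE gram_const_neq0. Qed.

(** Elevation does not change the polynomial, hence not its inner products either. *)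
Lemma gram_elev N a b : (b <= a)%N ->
  gram R d N a *m elev R d a b = gram R d N b.
Proof.
move=> ba; apply: bilinear_mx_inj => c c'.
rewrite mulmxA -[_ *m _ *m c']mulmxA -!dotL2_bernstein_form.
by rewrite -bernstein_form_elev.
Qed.

(** Inner products with the basis recover the coefficients because the Gram matrix is invertible. *)
Lemma bernstein_form_inj N : injective (@bernstein_form R d N).
Proof.
move=> c c' cc'; apply: (can_inj (mulKmx (gram_unit N))).
apply/matrixP => i j; rewrite ord1.
have := dotL2_bernstein_form (delta_mx i 0) c.
by rewrite cc' dotL2_bernstein_form trmx_delta -!mulmxA -!rowE !mxE.
Qed.

(** [elev] shows that an elevation matrix exists, so the one picked by [xget] is genuine;
    injectivity of [bernstein_form] makes it unique. *)
Lemma elevation_mxE a b : (b <= a)%N -> elevation_mx R d a b = elev R d a b.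
Proof.
move=> ba; apply: mulmx_cV_inj => c; apply: bernstein_form_inj.
have elevP : is_elevation_mx (elev R d a b).
  by move=> p c' _ ->; exact: bernstein_form_elev.
rewrite -bernstein_form_elev//; apply/esym.
apply: (xgetPex 0 (ex_intro _ _ elevP)) => //.
by apply/bernstein_spanP; exists c.
Qed.

Lemma elev_comp a b c : (c <= b)%N -> (b <= a)%N ->
  elev R d a b *m elev R d b c = elev R d a c.
Proof.
move=> cb ba; apply: mulmx_cV_inj => v; apply: bernstein_form_inj.
by rewrite -mulmxA -!bernstein_form_elev// (leq_trans cb).
Qed.

(** These are the normal equations, obtained by testing orthogonality against all Bernstein forms of
    degree [b]. *)
Lemma is_projection_mxP a b (P : 'M[R]_(dimP d b, dimP d a)) :
  is_projection_mx P <-> gram R d b b *m P = gram R d b a.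
Proof.
have dotB p q r : dotL2 (p - q) r = dotL2 p r - dotL2 q r.
  move=> *; rewrite !dotL2E -scaleN1r addrC mulrDl -scalerAl simplex_int_lin.
  by rewrite mulN1r addrC.
have dotC p q : dotL2 p q = dotL2 q p by rewrite !dotL2E mulrC.
split=> [PP|GP p c _ ->].
  apply: bilinear_mx_inj => c c'.
  have form_space N v : poly_space N (@bernstein_form R d N v).
    by apply/bernstein_spanP; exists v.
  have [_ /(_ _ (form_space _ c))/eqP] := PP _ c' (form_space _ c') erefl.
  rewrite dotB subr_eq0 ![dotL2 _ (bernstein_form c)]dotC !dotL2_bernstein_form.
  by rewrite !mulmxA => /eqP.
split; first by apply/bernstein_spanP; eexists.
move=> r /bernstein_spanP[c' ->].
rewrite dotB ![dotL2 _ (bernstein_form c')]dotC !dotL2_bernstein_form.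
by rewrite mulmxA -[_ *m _ *m P]mulmxA GP subrr.
Qed.

End Projection.

Theorem theorem5p3 (R : realType) (d N M : nat) (d_ge1 : (1 <= d)%N) :
  exists c : 'I_N.+1 -> R,
    projection_mx R d (N + M) N =
    \sum_(j < N.+1) c j *:
      (elevation_mx R d N (N - j) *m (elevation_mx R d N (N - j))^T
         *m (elevation_mx R d (N + M) N)^T).
Proof.
have [e addbinE] := @addbinmx_decomp R d N M.
(* The two [gram_const] factors convert between T and the Gram matrices of degrees (N, N + M) and
   (N, N - j); the binomial undoes the normalisation of [elev] from degree N - j to N + M. *)
pose c (j : 'I_N.+1) := gram_const R d N (N + M) * e j *
  (gram_const R d N (N - j))^-1 * 'C(N + M, N - j)%:R.
exists c; set Q := \sum_(j < N.+1) _.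
have QP : gram R d N N *m Q = gram R d N (N + M).
  rewrite [RHS]gramE -/(gram_const R d N (N + M)) addbinE mulmx_sumr scaler_sumr.
  apply: eq_bigr => j _; have jN : (N - j <= N)%N := leq_subr _ _.
  have NM : (N <= N + M)%N := leq_addr _ _.
  (* The two transposed elevations merge into one from degree N - j to N + M, and the remaining one
     is absorbed by the Gram matrix. *)
  rewrite !elevation_mxE// -scalemxAr -mulmxA -trmx_mul elev_comp// mulmxA gram_elev//.
  rewrite gramE -/(gram_const R d N (N - j)) /elev linearZ/=
    -scalemxAl -scalemxAr !scalerA.
  congr (_ *: _); rewrite /c.
  have g0 := gram_const_neq0 R d N (N - j).
  have C0 : 'C(N + M, N - j)%:R != 0 :> R.
    by rewrite pnatr_eq0 -lt0n bin_gt0 (leq_trans jN).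
  by move: (gram_const _ _ _ _) ('C(_, _)%:R) g0 C0 => u v u0 v0; field; rewrite ?u0 ?v0.
(* The normal equations have only one solution, and [Q] also witnesses that the choice by [xget] in
   [projection_mx] satisfies them. *)
apply: (can_inj (mulKmx (gram_unit R d N))); rewrite QP.
apply/is_projection_mxP; apply: (xgetPex 0).
by exists Q; apply/is_projection_mxP.
Qed.
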